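(* (Matrix Phasor Addition Formula) Let $M,N,U$ be complex $n\times n$ matrices such that $M+N$ and $M-N$ are invertible and $M$, $N$ and $U$ commute. Let $M_0,N_0$ be, respectively, the square roots of $M+N$ and $M-N$ constructed as in the context, and let $U_0$ be the logarithm of $N_0^{-1}M_0$ constructed as in the context. Then $$M\cosh U+N\sinh U=M_0N_0\cosh(U_0+U)=\sqrt{(M+N)(M-N)}\,\cosh\Bigl(\ln\bigl[(\sqrt{M-N})^{-1}\sqrt{M+N}\bigr]+U\Bigr).$$
   Context: For an invertible complex matrix $W$ whose minimal polynomial has distinct roots $\lambda_1,\dots,\lambda_j$ with multiplicities $\mu_1,\dots,\mu_j$: (Square root.) The square root $\sqrt W$ is $p(W)$, where $p\in\mathbb C[x]$ is the interpolating polynomial satisfying $p^{(r)}(\lambda_k)=h^{(r)}(\lambda_k)$ for $0\le r\le\mu_k-1$ and all $k$, with $h$ the principal branch of the square root in $\mathbb C$. It satisfies $p(W)^2=W$ and commutes with every matrix commuting with $W$. (Logarithm.) The logarithm $\ln W$ is $q(W)$, where $q\in\mathbb C[x]$ is obtained in the same way with the principal branch of the logarithm in $\mathbb C$ in place of $h$. It satisfies $e^{q(W)}=W$ and commutes with every matrix commuting with $W$. $\cosh$ and $\sinh$ of matrices are given by their power series.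
   Formalization: In the last expression √((M+N)(M−N)) is read as the square root M₀N₀, since the principal root fails (n=1, M=−1, N=U=0); at negative real eigenvalues the derivatives of the principal branches are those of their continuation from above. *)

(* Defs.v *)
From HB Require Import structures.
From mathcomp Require Import all_boot all_order all_algebra.
From mathcomp Require Import complex.
From mathcomp Require Import all_classical all_reals all_analysis.
Set Implicit Arguments. Unset Strict Implicit. Unset Printing Implicit Defensive.
Import Order.TTheory GRing.Theory Num.Theory.
Import numFieldNormedType.Exports.
Local Open Scope classical_set_scope.
Local Open Scope complex_scope.
Local Open Scope ring_scope.

(* Principal argument, in ]-pi, pi]. *)
Definition carg (R : realType) (z : R[i]) : R :=
  let t := acos (complex.Re z / complex.Re `|z|) in
  if 0 <= complex.Im z then t else - t.

Definition cln (R : realType) (z : R[i]) : R[i] :=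
  ln (complex.Re `|z|) +i* carg z.

(* The principal branches are holomorphic off the nonpositive reals.  At a
   negative real a (a < 0 in the order of R[i] says exactly this) the derivatives
   of h are those of its continuation across the cut from above, the side from
   which h is continuous: for z near a with Im z >= 0, sqrtc z = 'i sqrtc (- z)
   and cln z = cln (- z) + pi 'i, and the right-hand sides are holomorphic near a. *)
Definition sqrt_germ (R : realType) (a : R[i]) : R[i] -> R[i] :=
  if a < 0 then fun z => 'i%C * sqrtc (- z) else @sqrtc R.

Definition ln_germ (R : realType) (a : R[i]) : R[i] -> R[i] :=
  if a < 0 then fun z => cln (- z) + (0 +i* pi) else @cln R.

(* [h a] is the germ at a of the interpolated function; the multiplicity is 0,
   and the condition void, unless a is a root of the minimal polynomial. *)
Definition interpolates (K : numClosedFieldType) n (h : K -> K -> K)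
    (W : 'M[K]_n.+1) (p : {poly K}) : Prop :=
  forall (a : K) (r : nat), (r < mup a (mxminpoly W))%N ->
    (derivn r p).[a] = derive1n r (h a) a.

(* Hermite interpolation always has a solution (so the default 0 is not reached),
   and by interpolates_uniq below the value does not depend on the choice. *)
Definition primary_fun (K : numClosedFieldType) n (h : K -> K -> K)
    (W : 'M[K]_n.+1) : 'M[K]_n.+1 :=
  horner_mx W (xget 0 [set p | interpolates h W p]).

Definition sqrtmx (R : realType) n (W : 'M[R[i]]_n.+1) : 'M[R[i]]_n.+1 :=
  primary_fun (@sqrt_germ R) W.

Definition lnmx (R : realType) n (W : 'M[R[i]]_n.+1) : 'M[R[i]]_n.+1 :=
  primary_fun (@ln_germ R) W.

Definition coshmx (K : numClosedFieldType) n (U : 'M[K]_n.+1) : 'M[K]_n.+1 :=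
  limn (series (fun k : nat => ((2 * k)`!%:R : K)^-1 *: U ^+ (2 * k))).

Definition sinhmx (K : numClosedFieldType) n (U : 'M[K]_n.+1) : 'M[K]_n.+1 :=
  limn (series (fun k : nat => ((2 * k).+1`!%:R : K)^-1 *: U ^+ (2 * k).+1)).

Lemma sqrt_germ_val (R : realType) (a : R[i]) : sqrt_germ a a = sqrtc a.
Proof.
rewrite /sqrt_germ; case: ifP => // a0.
case: a a0 => x y; rewrite ltcE /= => /andP[/eqP y0 x0].
subst y.
have z2 : (0 : R) ^+ 2 = 0 by rewrite expr0n.
have sx : Num.sqrt (x ^+ 2) = - x by rewrite sqrtr_sqr ltr0_norm.
rewrite /sqrtc /= oppr0 eqxx z2 !addr0 sqrrN sx !mul1r subrr mul0r sqrtr0.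
rewrite (addrC _ x) subrr mul0r sqrtr0.
set t := Num.sqrt _.
by rewrite /GRing.mul /= !(mul0r, mul1r) subrr add0r.
Qed.

Lemma ln_germ_val (R : realType) (a : R[i]) : ln_germ a a = cln a.
Proof.
rewrite /ln_germ; case: ifP => // a0.
case: a a0 => x y; rewrite ltcE /= => /andP[/eqP y0 x0].
subst y.
have z2 : (0 : R) ^+ 2 = 0 by rewrite expr0n.
have sx : Num.sqrt (x ^+ 2) = - x by rewrite sqrtr_sqr ltr0_norm.
have x1 : x / x = 1 by rewrite divff// lt_eqF.
rewrite /cln /carg /= oppr0 z2 !addr0 sqrrN sx lexx.
rewrite invrN mulrNN mulrN x1 acos1 acosN1.
by rewrite /Algebra.add /= addr0 add0r.
Qed.

Lemma interpolates_uniq (K : numClosedFieldType) n h (W : 'M[K]_n.+1) p q :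
  interpolates h W p -> interpolates h W q -> horner_mx W p = horner_mx W q.
Proof.
move=> hp hq; apply/eqP; rewrite -subr_eq0 -rmorphB /= -dvd_mxminpoly.
set d := p - q.
have m0 : mxminpoly W != 0 by rewrite monic_neq0 ?mxminpoly_monic.
have [->|d0] := eqVneq d 0; first by rewrite dvdp0.
have dv a r : (r < mup a (mxminpoly W))%N -> (derivn r d).[a] = 0.
  by move=> ra; rewrite derivnB hornerD hornerN hp// hq// subrr.
have pow a : ('X - a%:P) ^+ mup a (mxminpoly W) %| d.
  have : d^:P.[a%:P + ('X - a%:P)] = d.
    by rewrite addrC subrK -/(d \Po 'X) comp_polyXr.
  rewrite nderiv_taylor; last exact: mulrC.
  move=> <-; apply: (big_ind (fun e => _ %| e)) => [|e f|i _].
  - exact: dvdp0.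
  - exact: dvdp_add.
  have [im|mi] := ltnP i (mup a (mxminpoly W)); last first.
    by rewrite dvdp_mull// dvdp_exp2l.
  rewrite nderivn_map horner_map /=.
  have := dv _ _ im; rewrite nderivn_def hornerMn => /eqP.
  by rewrite mulrn_eq0 eqn0Ngt fact_gt0 /= => /eqP ->; rewrite mul0r dvdp0.
have [s Ws] := closed_field_poly_normal (mxminpoly W).
move: Ws pow; rewrite (monicP (mxminpoly_monic W)) scale1r => -> {dv hp hq}.
elim: s d d0 => [|x s IHs] d d0 pow; first by rewrite big_nil dvd1p.
have /dvdpP[e de] : 'X - x%:P %| d.
  apply: dvdp_trans (pow x); rewrite mu_prod_XsubC /= eqxx.
  by rewrite exprS dvdp_mulr.
have e0 : e != 0 by apply: contraNneq d0 => e0; rewrite de e0 mul0r.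
rewrite big_cons de mulrC dvdp_mul2r ?polyXsubC_eq0//.
apply: IHs => // a; rewrite -mup_geq//.
have := pow a; rewrite -mup_geq// de mupM ?polyXsubC_eq0//.
by rewrite !mu_prod_XsubC /= -(expr1 ('X - x%:P)) mup_XsubCX addnC;
  case: (x == a); rewrite ?addn1 ?addn0.
Qed.

(* Main.v *)
(* Let M0, N0 be the square roots of M + N, M - N and U0 the logarithm of N0^-1 M0; they
   commute with each other and with U.  Then M0 N0 e^U0 = M0^2 = M + N and
   M0 N0 e^-U0 = N0^2 = M - N, so that expanding
   2 M0 N0 cosh (U0 + U) = M0 N0 (e^U0 e^U + e^-U0 e^-U) gives 2 (M cosh U + N sinh U).

   That the Hermite interpolants of the square root and of the logarithm do have the
   square W and the exponential W is checked locally at each eigenvalue a <> 0,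
   through the differential equation z f' = c f + d (c = 1/2, d = 0 for the root,
   c = 0, d = 1 for the logarithm).  An interpolant p then satisfies
   X p' = c p + d modulo (X - a)^(m-1), hence p^2 - X, respectively the truncated
   exponential series of p minus X, is a polynomial g with X g' = g modulo
   (X - a)^(m-1) and g(a) = 0; since a <> 0 this forces (X - a)^m to divide g. *)
Require Import Defs.
From mathcomp Require Import all_boot all_order all_algebra.
From mathcomp Require Import complex.
From mathcomp Require Import all_classical all_reals all_analysis.
From mathcomp Require Import ring lra.
Set Implicit Arguments. Unset Strict Implicit. Unset Printing Implicit Defensive.
Import Order.TTheory GRing.Theory Num.Theory.
Import numFieldNormedType.Exports.
Local Open Scope classical_set_scope.
Local Open Scope ring_scope.

(** * Polynomials modulo powers of a linear factor *)

Section PolyLocal.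
Variable K : numClosedFieldType.
Implicit Types (a c : K) (p q d e : {poly K}) (m r : nat).

(** In the Taylor expansion at [a] the terms of order at least [m] are multiples of the power and
    the others vanish; characteristic 0 allows the division by [r!]. *)
Lemma dvdp_XsubC_exp_derivn a m d :
  (forall r, (r < m)%N -> (derivn r d).[a] = 0) -> ('X - a%:P) ^+ m %| d.
Proof.
move=> dv.
have <- : d^:P.[a%:P + ('X - a%:P)] = d.
  by rewrite addrC subrK -/(d \Po 'X) comp_polyXr.
rewrite nderiv_taylor; last exact: mulrC.
apply: (big_ind (fun e => _ %| e)) => [|e f|i _]; [exact: dvdp0|exact: dvdp_add|].
have [im|mi] := ltnP i m; last by rewrite dvdp_mull// dvdp_exp2l.
rewrite nderivn_map horner_map /=.
have := dv _ im; rewrite nderivn_def hornerMn => /eqP.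
by rewrite mulrn_eq0 eqn0Ngt fact_gt0 /= => /eqP ->; rewrite mul0r dvdp0.
Qed.

Lemma derivn_XsubC_exp a m r :
  derivn r (('X - a%:P) ^+ m) = ('X - a%:P) ^+ (m - r) *+ m ^_ r.
Proof.
elim: r => [|r IH]; first by rewrite derivn0 subn0 ffactn0 mulr1n.
rewrite derivnS IH derivMn deriv_exp derivXsubC mul1r -mulrnA subnS.
by rewrite ffactnSr mulnC.
Qed.

Lemma derivn_dvdp_XsubC_exp a m r d :
  ('X - a%:P) ^+ m %| d -> (r < m)%N -> (derivn r d).[a] = 0.
Proof.
elim: r m d => [|r IH] [//|m] d /dvdpP[e ->].
  by rewrite derivn0 exprS hornerM hornerM hornerXsubC subrr mul0r mulr0.
rewrite ltnS derivSn => rm; apply: IH rm.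
rewrite derivM deriv_exp derivXsubC mul1r /= mulrnAr -mulrnAl.
by rewrite dvdp_add ?dvdp_mull ?dvdp_exp2l.
Qed.

(* If ('X - a) ^+ k divides d exactly, with k > 0, it divides 'X * d^`() only to
   the order k - 1, so that k cannot be smaller than m. *)
Lemma dvdp_XsubC_exp_euler a c m d : a != 0 -> d.[a] = 0 ->
  ('X - a%:P) ^+ m.-1 %| 'X * d^`() - c *: d -> ('X - a%:P) ^+ m %| d.
Proof.
move=> a0 da; case: m => [|m] /=; first by rewrite expr0 !dvd1p.
move=> H.
suff : forall k, (k <= m)%N -> ('X - a%:P) ^+ k.+1 %| d by apply.
elim=> [|k IH] km; first by rewrite expr1 dvdp_XsubCl; apply/rootP.
have /dvdpP[e de] := IH (ltnW km).
have dd : d^`() = e^`() * ('X - a%:P) ^+ k.+1 + e * ('X - a%:P) ^+ k *+ k.+1.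
  by rewrite de derivM deriv_exp derivXsubC mul1r /= mulrnAr.
have : ('X - a%:P) ^+ k.+1 %| 'X * e * ('X - a%:P) ^+ k *+ k.+1.
  have -> : 'X * e * ('X - a%:P) ^+ k *+ k.+1
      = ('X * d^`() - c *: d) + c *: d - 'X * e^`() * ('X - a%:P) ^+ k.+1.
    by rewrite subrK dd mulrDr !mulrA addrAC subrr add0r mulrnAr mulrA.
  apply: dvdp_sub; last exact: dvdp_mull.
  apply: dvdp_add; first by apply: dvdp_trans H; exact: dvdp_exp2l.
  by rewrite de -mul_polyC dvdp_mull// dvdp_mull.
(* The integer factor is invertible in characteristic 0; cancelling [('X - a) ^+ k] leaves ['X * e]
   divisible by ['X - a], hence [e] as well since [a != 0]. *)
rewrite -scaler_nat dvdpZr ?pnatr_eq0// exprS.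
rewrite dvdp_mul2r ?expf_neq0 ?polyXsubC_eq0// dvdp_XsubCl /root hornerM hornerX.
rewrite mulf_eq0 (negPf a0) /= -/(root e a) -dvdp_XsubCl => ae.
by rewrite de exprS dvdp_mul2r// expf_neq0 ?polyXsubC_eq0.
Qed.

Lemma taylor_exists a m (v : nat -> K) :
  exists p, forall r, (r < m)%N -> (derivn r p).[a] = v r.
Proof.
elim: m => [|m [p pv]]; first by exists 0.
(* The added power has [m]-th derivative [m!] at [a] and vanishing lower derivatives there, so it
   corrects order [m] without disturbing the lower ones. *)
pose x := (v m - (derivn m p).[a]) / m`!%:R.
exists (p + x *: ('X - a%:P) ^+ m) => r.
rewrite ltnS leq_eqVlt derivnD derivnZ derivn_XsubC_exp hornerD => /orP[/eqP->|rm].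
  rewrite subnn expr0 ffactnn hornerZ hornerMn hornerC divfK ?subrKC//;
    by rewrite pnatr_eq0 -lt0n fact_gt0.
rewrite pv// hornerZ hornerMn horner_exp hornerXsubC subrr expr0n.
by rewrite subn_eq0 leqNgt rm mul0rn mulr0 addr0.
Qed.

Lemma coprimep_XsubC_exp_prod b m (mu : K -> nat) (s : seq K) : b \notin s ->
  coprimep (\prod_(a <- s) ('X - a%:P) ^+ mu a) (('X - b%:P) ^+ m).
Proof.
move=> bs; apply: coprimep_expr.
rewrite coprimep_XsubC rootE horner_prod prodf_seq_neq0.
apply/allP => a as_ /=; rewrite horner_exp hornerXsubC expf_neq0// subr_eq0.
by apply: contraNneq bs => ->.
Qed.

Lemma crt_XsubC_exp (mu : K -> nat) (t : K -> {poly K}) (s : seq K) : uniq s ->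
  exists p, forall a, a \in s -> ('X - a%:P) ^+ mu a %| p - t a.
Proof.
elim: s => [|b s IH] /=; first by exists 0.
move=> /andP[bs /IH[p ps]].
have := coprimep_XsubC_exp_prod (mu b) mu bs.
set A := \prod_(a <- s) _; set B := (_ - _) ^+ _.
move=> /Bezout_eq1_coprimepP[[u w] /= uw].
(* [u * A] is 1 modulo [B] and 0 modulo the factors of [A]: the correction moves [p] to [t b] at [b]
   and keeps the earlier congruences. *)
exists (p + u * A * (t b - p)) => a; rewrite inE => /orP[/eqP->|as_].
  have -> : p + u * A * (t b - p) - t b = (p - t b) * (w * B).
    by rewrite -(addKr (u * A) (w * B)) uw; ring.
  by rewrite mulrA dvdp_mull.
rewrite addrAC dvdp_add ?ps// mulrAC dvdp_mull//.
by rewrite /A (big_rem a)//= dvdp_mulr.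
Qed.

End PolyLocal.

(** * Localisation at the roots of the minimal polynomial, and Hermite interpolation *)

Section MinpolyLocal.
Variables (K : numClosedFieldType) (n : nat) (W : 'M[K]_n.+1).
Implicit Types (a : K) (p q : {poly K}) (D : 'M[K]_n.+1).

Let m := mxminpoly W.
Let m0 : m != 0. Proof. by rewrite monic_neq0 ?mxminpoly_monic. Qed.

(** At [W] it annihilates every generalized eigenspace except that of [a], so an identity multiplied
    by it is tested at [a] alone. *)
Definition minpoly_cofactor a := m %/ ('X - a%:P) ^+ mup a m.

Lemma minpoly_cofactorK a : minpoly_cofactor a * ('X - a%:P) ^+ mup a m = m.
Proof. by rewrite divpK// -mup_geq. Qed.

Lemma minpoly_cofactor_neq0 a : (minpoly_cofactor a).[a] != 0.
Proof.
apply/negP => /eqP/rootP; rewrite -dvdp_XsubCl => /dvdpP[e ae].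
have : ('X - a%:P) ^+ (mup a m).+1 %| m.
  by rewrite -{2}(minpoly_cofactorK a) ae -mulrA -exprS dvdp_mull.
by rewrite -mup_geq// ltnn.
Qed.

Lemma horner_mx_cofactor a p : ('X - a%:P) ^+ mup a m %| p ->
  horner_mx W p * horner_mx W (minpoly_cofactor a) = 0.
Proof.
move=> /dvdpP[e ->]; rewrite -rmorphM -mulrA [_ ^+ _ * _]mulrC minpoly_cofactorK.
by rewrite rmorphM /= mx_root_minpoly mulr0.
Qed.

(* The polynomials p with [D * p(W) = 0] form an ideal, and the cofactors have no
   common root. *)
Lemma eq0_minpoly_cofactor D :
  (forall a, root m a -> D * horner_mx W (minpoly_cofactor a) = 0) -> D = 0.
Proof.
move=> D0; have [s ms] := closed_field_poly_normal m.
have sm a : (a \in s) = root m a.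
  by rewrite ms rootZ ?lead_coef_eq0// root_prod_XsubC.
pose g := \big[@gcdp K/m]_(a <- s) minpoly_cofactor a.
have gm : g %| m.
  rewrite /g; elim: (s) => [|a t IH]; first by rewrite big_nil.
  by rewrite big_cons (dvdp_trans _ IH) ?dvdp_gcdr.
have ga a : a \in s -> g %| minpoly_cofactor a.
  rewrite /g; elim: (s) => // b t IH; rewrite inE big_cons => /orP[/eqP->|/IH at_].
    exact: dvdp_gcdl.
  by rewrite (dvdp_trans _ at_) ?dvdp_gcdr.
have Dg : D * horner_mx W g = 0.
  rewrite /g; have : {subset s <= root m} by move=> a; rewrite sm.
  elim: (s) => [|a t IH] st; first by rewrite big_nil mx_root_minpoly mulr0.
  have Da : D * horner_mx W (minpoly_cofactor a) = 0.
    by apply: D0; apply: (st a); rewrite mem_head.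
  have {}IH : D * horner_mx W (\big[@gcdp K/m]_(a <- t) minpoly_cofactor a) = 0.
    by apply: IH => b bt; apply: st; rewrite inE bt orbT.
  rewrite big_cons; move: Da IH.
  set p := minpoly_cofactor a; set q := \big[_/_]_(_ <- _) _ => Dp Dq.
  have [u /eqpP[[x y] /= /andP[x0 y0] uE]] := Bezoutp p q.
  rewrite -[gcdp p q](scalerK y0) -uE mulrC (mulrC u.2).
  rewrite !(linearZ, linearD, rmorphM, mulrDr) /= -!scalerAr mulrDr.
  by rewrite !mulrA Dp Dq !mul0r addr0 !scaler0.
(* A root [b] of [g] would be a root of [m], and then of the cofactor at [b], which does not vanish
   there. *)
have /size_poly1P[c c0 gc] : size g == 1%N.
  apply/contraT => /closed_rootP[b gb].
  have bs : b \in s by rewrite sm; apply: root_dvdp gb.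
  have := minpoly_cofactor_neq0 b; rewrite -rootE.
  by rewrite (root_dvdp (ga _ bs)).
move: Dg; rewrite gc horner_mx_C -scalemx1 -scalerAr mulr1 => /eqP.
by rewrite scaler_eq0 (negPf c0) => /eqP.
Qed.

Lemma mup_minpoly_gt0 a : (0 < mup a m)%N = root m a.
Proof. by rewrite mup_geq// expr1 dvdp_XsubCl. Qed.

(** Taylor polynomials at the roots are glued by the Chinese remainder theorem; [undup] makes the
    listed roots distinct. *)
Lemma interpolates_exists (h : K -> K -> K) : exists p, interpolates h W p.
Proof.
have [s ms] := closed_field_poly_normal m.
have /choice[t tv] : forall a, exists p : {poly K}, forall r, (r < mup a m)%N ->
    (derivn r p).[a] = derive1n r (h a) a.
  by move=> a; exact: (taylor_exists a (mup a m) (fun r => derive1n r (h a) a)).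
have [p ps] := crt_XsubC_exp (fun a => mup a m) t (undup_uniq s).
exists p => a r ra; rewrite -tv//; apply/eqP; rewrite -subr_eq0 -hornerN -hornerD.
rewrite -derivnB; apply/eqP; apply: (derivn_dvdp_XsubC_exp _ ra).
apply: ps; rewrite mem_undup.
have -> : (a \in s) = root m a.
  by rewrite ms rootZ ?lead_coef_eq0// root_prod_XsubC.
by rewrite -mup_minpoly_gt0 (leq_ltn_trans _ ra).
Qed.

Lemma primary_funP (h : K -> K -> K) : exists2 p,
  interpolates h W p & primary_fun h W = horner_mx W p.
Proof.
exists (xget 0 [set p | interpolates h W p]) => //.
by case: xgetP => // noP; have [p /noP] := interpolates_exists h.
Qed.

End MinpolyLocal.

Lemma mxminpoly_root_neq0 (K : fieldType) n (W : 'M[K]_n.+1) a :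
  W \in unitmx -> root (mxminpoly W) a -> a != 0.
Proof.
move=> Wu; apply: contraTneq => ->; rewrite -eigenvalue_root_min.
apply/eigenvalueP => -[v].
move=> /(congr1 (mulmx^~ (invmx W))); rewrite mulmxK// scale0r mul0mx => ->.
by rewrite eqxx.
Qed.

(** * Interpolants of solutions of z f' = c f + d *)

Section EulerGerm.
Variable K : numClosedFieldType.
Implicit Types (f : K -> K) (a c d z : K).

(** Differentiating z f' = c f + d [r] times gives z f^(r+1) = (c - r) f^(r) + d^(r), where the
    constant survives for r = 0 only. *)
Lemma near_is_derive_derive1n f a c d : a != 0 ->
  (\forall z \near a, is_derive (z : K) 1 f ((c * f z + d) / z)) ->
  forall r, \forall z \near a, is_derive (z : K) 1 (derive1n r f)
    (((c - r%:R) * derive1n r f z + d *+ (r == 0)) / z).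
Proof.
move=> a0 fa; elim=> [|r IH].
  by near do rewrite subr0 mulr1n; exact: fa.
have an0 : \forall z \near a, (z : K) != 0.
  exact: (@cvgr_neq0 _ _ _ (nbhs a) _ id a (fun A => id) a0).
(* Differentiating again at [z] requires the formula on a neighbourhood of [z], not only at [z]. *)
have IH2 := near_join IH.
near=> z.
have z0 : z != 0 by near: z.
set k := fun w => ((c - r%:R) * derive1n r f w + d *+ (r == 0)) / w.
have zk : \forall w \near z, derive1n r.+1 f (w : K) = k w.
  have : \forall w \near z, is_derive (w : K) 1 (derive1n r f) (k w).
    by near: z; exact: IH2.
  apply: filterS => w wk; rewrite derive1nS derive1E; exact: derive_val.
have fz : is_derive z 1 (derive1n r f) (k z) by near: z.
rewrite (nbhs_singleton zk) mulr0n addr0.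
apply: (@near_eq_is_derive _ _ _ k).
  by apply: filterS zk.
have idV : is_derive z 1 (fun w : K => w^-1) (- z ^- 2).
  apply: DeriveDef; first exact: derivableV.
  by rewrite deriveV// derive_val scaler1.
have num : is_derive z 1 ((c - r%:R) *: derive1n r f + cst (d *+ (r == 0)))
    ((c - r%:R) * k z).
  by apply: is_derive_eq; rewrite addr0.
have -> : k = ((c - r%:R) *: derive1n r f + cst (d *+ (r == 0))) * (fun w => w^-1).
  by [].
apply: is_derive_eq.
change (((c - r%:R) * derive1n r f z + d *+ (r == 0)) * - z ^- 2
  + z^-1 * ((c - r%:R) * k z) = (c - r.+1%:R) * k z / z).
by rewrite /k -natr1; field.
Unshelve. all: by end_near. Qed.

(** The derivatives of order r < m - 1 vanish at [a] by the differentiated equation; order r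
    involves the derivative of [p] of order r + 1, whence the loss of one in the exponent. *)
Lemma euler_interpolation f a c d p m : a != 0 ->
  (\forall z \near a, is_derive (z : K) 1 f ((c * f z + d) / z)) ->
  (forall r, (r < m)%N -> (derivn r p).[a] = derive1n r f a) ->
  ('X - a%:P) ^+ m.-1 %| 'X * p^`() - c *: p - d%:P.
Proof.
move=> a0 fa pf; apply: dvdp_XsubC_exp_derivn => r; rewrite ltn_predRL => rm.
have r_m : (r < m)%N by exact: ltnW.
have dX q : derivn r ('X * q) = 'X * derivn r q + derivn r.-1 q *+ r.
  elim: r {rm r_m} => [|r IH]; first by rewrite !derivn0 mulr0n addr0.
  rewrite derivnS IH derivD derivM derivX mul1r derivMn -derivnS.
  case: r {IH} => [|r]; first by rewrite mulr0n addr0 addrC.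
  by rewrite -derivnS [in RHS]mulrS addrA [_ + 'X * _]addrC.
have dC : (derivn r d%:P).[a] = d *+ (r == 0).
  by case: (r) => [|k]; rewrite ?derivnC ?hornerC// mulr1n.
have /nbhs_singleton[_ rE] := near_is_derive_derive1n a0 fa r.
have {}rE : a * derive1n r.+1 f a = (c - r%:R) * derive1n r f a + d *+ (r == 0).
  by rewrite derive1nS derive1E rE mulrC divfK.
rewrite !derivnB dX -derivSn derivnZ !hornerE dC hornerMn.
have -> : (derivn r.-1 p^`()).[a] *+ r = r%:R * derive1n r f a.
  rewrite -pf; last exact: r_m.
  by rewrite mulr_natl; case: (r) => // k; rewrite -derivSn.
by rewrite (pf r.+1)// (pf r)// rE; ring.
Qed.

End EulerGerm.

(** * The matrix exponential *)

Section ExpSum.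
Variables (F : numFieldType) (A : algType F).
Implicit Types (a b : A).

(** Truncated exponential over any algebra: it is used for matrices, for polynomials and for the
    reals. *)
Definition expsum a (k : nat) : A := series (fun i => (i`!%:R : F)^-1 *: a ^+ i) k.

Lemma expsumE a k : expsum a k = \sum_(i < k) (i`!%:R : F)^-1 *: a ^+ i.
Proof. by rewrite /expsum /series /= big_mkord. Qed.

Lemma expsum0 a : expsum a 0 = 0.
Proof. by rewrite expsumE big_ord0. Qed.

Lemma expsumS a k : expsum a k.+1 = expsum a k + (k`!%:R : F)^-1 *: a ^+ k.
Proof. by rewrite !expsumE big_ord_recr. Qed.

(** The product runs over the square i, j < k and, by the binomial formula, the truncation at a + b
    over the triangle i + j < k; what remains has nonnegative coefficients, ready for comparison
    with the reals. *)
Lemma expsumM_subD a b k : GRing.comm a b ->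
  expsum a k * expsum b k - expsum (a + b) k =
  \sum_(i < k) \sum_(k - i <= j < k)
    ((i`!%:R)^-1 * (j`!%:R)^-1 : F) *: (a ^+ i * b ^+ j).
Proof.
move=> ab; pose f i j := ((i`!%:R)^-1 * (j`!%:R)^-1 : F) *: (a ^+ i * b ^+ j).
have ED : expsum (a + b) k = \sum_(i < k) \sum_(0 <= j < k - i) f i j.
  rewrite expsumE; elim: k => [|k IH]; first by rewrite !big_ord0.
  rewrite big_ord_recr IH /= [RHS]big_ord_recr /= subSnn big_nat1.
  under [in RHS]eq_bigr => i _ do rewrite subSn ?(ltnW (ltn_ord i))// big_nat_recr//=.
  rewrite big_split /= -addrA; congr (_ + _).
  rewrite (addrC a) exprDn_comm; last exact/commr_sym.
  rewrite big_ord_recr /= subnn binn mulr1n expr0 mul1r scalerDr; congr (_ + _).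
    rewrite scaler_sumr; apply: eq_bigr => i _.
    have ik : (i <= k)%N := ltnW (ltn_ord i).
    rewrite -scalerMnr scalerMnl /f; congr (_ *: _); last first.
      by apply: commrX; apply: commr_sym; apply: commrX.
    rewrite -(bin_fact ik) !natrM -mulr_natr.
    by field; rewrite !pnatr_eq0 -!lt0n !fact_gt0 bin_gt0 ik.
  by rewrite /f fact0 invr1 mulr1 expr0 mulr1.
have EM : expsum a k * expsum b k = \sum_(i < k) \sum_(0 <= j < k) f i j.
  rewrite !expsumE mulr_suml; apply: eq_bigr => i _.
  rewrite mulr_sumr big_mkord; apply: eq_bigr => j _.
  by rewrite -scalerAl -scalerAr scalerA.
rewrite ED EM -sumrB; apply: eq_bigr => i _.
by rewrite (@big_cat_nat _ _ _ (k - i)%N) ?leq_subr//= addrAC subrr add0r.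
Qed.

End ExpSum.

(** * Convergence of matrices and of complex sequences *)

Section MatrixCvg.
Variable K : numFieldType.

Lemma cvg_mxP m n (u : nat -> 'M[K]_(m, n)) (L : 'M[K]_(m, n)) :
  (forall i j, (fun k => u k i j) @ \oo --> L i j) -> u @ \oo --> L.
Proof.
move=> uL B [P LP PB].
have : \forall k \near \oo, forall ij : 'I_m * 'I_n, P ij.1 ij.2 (u k ij.1 ij.2).
  by apply: filter_forall => -[i j]; apply: uL; apply: LP.
by apply: filterS => k uk; apply: PB => i j; have := uk (i, j).
Qed.

Lemma cvg_mx_coord m n (u : nat -> 'M[K]_(m, n)) (L : 'M[K]_(m, n)) i j :
  u @ \oo --> L -> (fun k => u k i j) @ \oo --> L i j.
Proof.
move=> uL; apply: (@cvg_comp _ _ _ u (fun M : 'M[K]_(m, n) => M i j) _ (nbhs L)) => //.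
exact: coord_continuous.
Qed.

Lemma cvg_mulmx m n p (u : nat -> 'M[K]_(m, n)) (v : nat -> 'M[K]_(n, p))
    (L : 'M[K]_(m, n)) (M : 'M[K]_(n, p)) :
  u @ \oo --> L -> v @ \oo --> M -> (fun k => u k *m v k) @ \oo --> L *m M.
Proof.
move=> uL vM; apply: cvg_mxP => i j; rewrite mxE.
under eq_fun do rewrite mxE.
apply: cvg_big => [|l _]; first exact: add_continuous.
by apply: cvgM; apply: cvg_mx_coord.
Qed.

End MatrixCvg.

Section ComplexCvg.
Variable R : realType.
Local Notation C := (R[i] : numClosedFieldType).
Implicit Types (z w : C).

(** The norm of [R[i]] takes its values in [R[i]]; this real-valued copy allows comparison with real
    sequences. *)
Definition absc z : R := complex.Re `|z|.

Lemma absc_normE z : (absc z)%:C%C = `|z|.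
Proof. by rewrite /absc RRe_real// normr_real. Qed.

Lemma absc_ge0 z : 0 <= absc z.
Proof. by rewrite -ler0c absc_normE. Qed.

Lemma absc_Re z : `|complex.Re z| <= absc z.
Proof. by rewrite -lecR absc_normE normc_ge_Re. Qed.

Lemma absc_Im z : `|complex.Im z| <= absc z.
Proof.
have := absc_Re (z * 'i%C); rewrite ReiNIm normrN /absc normrM.
have -> : `|'i%C : C| = 1 by rewrite normc_def /= expr0n expr1n add0r sqrtr1.
by rewrite mulr1.
Qed.

Lemma cvgC (T : Type) (F : set_system T) {FF : Filter F} (u : T -> C) (l : C) :
  ((fun t => complex.Re (u t)) @ F --> complex.Re l) ->
  ((fun t => complex.Im (u t)) @ F --> complex.Im l) -> u @ F --> l.
Proof.
have RC (v : T -> R) (x : R) : v @ F --> x ->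
    (fun t => (v t)%:C%C : C) @ F --> (x%:C%C : C).
  move=> /cvgrPdist_lt vx; apply/cvgrPdist_lt => e e0.
  have e0' : 0 < complex.Re e by move: e0; rewrite ltcE => /andP[].
  apply: filterS (vx _ e0') => t xvt.
  rewrite -rmorphB /= normc_def /= expr0n addr0 sqrtr_sqr.
  rewrite -[e]RRe_real; last by rewrite gtr0_real.
  by rewrite ltcR.
move=> uRe uIm; rewrite (complexE l).
rewrite (_ : u = fun t => (complex.Re (u t))%:C%C + 'i%C * (complex.Im (u t))%:C%C).
  by apply: cvgD; [|apply: cvgM; [exact: cvg_cst|]]; exact: RC.
by apply/funext => t; exact: complexE.
Qed.

Lemma Re_sum I (r : seq I) (P : pred I) (f : I -> C) :
  complex.Re (\sum_(i <- r | P i) f i) = \sum_(i <- r | P i) complex.Re (f i).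
Proof. exact: (raddf_sum (@complex.Re R : Rcomplex R -> R)). Qed.

Lemma Im_sum I (r : seq I) (P : pred I) (f : I -> C) :
  complex.Im (\sum_(i <- r | P i) f i) = \sum_(i <- r | P i) complex.Im (f i).
Proof. exact: (raddf_sum (@complex.Im R : Rcomplex R -> R)). Qed.

Lemma is_cvg_series_absc (a : nat -> C) (b : nat -> R) :
  (forall k, absc (a k) <= b k) -> cvgn (series b) ->
  exists l : C, series a @ \oo --> l.
Proof.
move=> ab cb.
have cvR (v : nat -> R) : (forall k, `|v k| <= absc (a k)) -> cvgn (series v).
  move=> va; apply: normed_cvg; apply: series_le_cvg cb => //= k.
    by rewrite (le_trans _ (ab k))// absc_ge0.
  by rewrite (le_trans (va k)).
have cRe := cvR (fun k => complex.Re (a k)) (fun k => absc_Re (a k)).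
have cIm := cvR (fun k => complex.Im (a k)) (fun k => absc_Im (a k)).
exists (Complex (limn (series (fun k => complex.Re (a k))))
                (limn (series (fun k => complex.Im (a k))))).
apply: cvgC => /=.
- by under eq_fun do rewrite Re_sum.
- by under eq_fun do rewrite Im_sum.
Qed.

Lemma cvg_absc_le (T : Type) (F : set_system T) {FF : Filter F} (u : T -> C) (l : C)
    (v : T -> R) :
  (\forall t \near F, absc (u t - l) <= v t) -> v @ F --> 0 -> u @ F --> l.
Proof.
move=> uv v0.
have absF (w : T -> R) : (\forall t \near F, `|w t| <= absc (u t - l)) -> w @ F --> 0.
  move=> wu; have /cvgN : v @ F --> 0 by [].
  rewrite oppr0 => Nv0.
  apply: (squeeze_cvgr _ Nv0 v0); near=> t.
  by rewrite -ler_norml (@le_trans _ _ (absc (u t - l)))//; near: t.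
have -> : l = l + 0 by rewrite addr0.
rewrite (_ : u = (fun t => l + (u t - l))); last by apply/funext => t; rewrite subrKC.
apply: cvgD; first exact: cvg_cst.
apply: cvgC => /=; apply: absF; apply: nearW => t; [exact: absc_Re|exact: absc_Im].
Unshelve. all: by end_near. Qed.

End ComplexCvg.

Section AbscTheory.
Variable R : realType.
Local Notation C := (R[i] : numClosedFieldType).

Lemma abscM (z w : C) : absc (z * w) = absc z * absc w.
Proof. by apply: complexI; rewrite rmorphM !absc_normE normrM. Qed.

Lemma absc_sum I (r : seq I) (P : pred I) (f : I -> C) :
  absc (\sum_(i <- r | P i) f i) <= \sum_(i <- r | P i) absc (f i).
Proof.
rewrite -lecR absc_normE rmorph_sum /=.
by under [leRHS]eq_bigr do rewrite absc_normE; exact: ler_norm_sum.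
Qed.

Lemma absc0 : absc (0 : C) = 0.
Proof. by apply: complexI; rewrite absc_normE normr0. Qed.

Lemma absc_nat k : absc (k%:R : C) = k%:R.
Proof. by apply: complexI; rewrite absc_normE normr_nat rmorph_nat. Qed.

Lemma absc_natV k : absc (k%:R^-1 : C) = k%:R^-1.
Proof. by apply: complexI; rewrite absc_normE normfV normr_nat fmorphV rmorph_nat. Qed.

End AbscTheory.

(** * Convergence and addition formula of the matrix exponential *)

Section ExpMx.
Variables (R : realType) (n : nat).
Local Notation C := (R[i] : numClosedFieldType).
Implicit Types (A B : 'M[C]_n.+1).

Definition expmx A : 'M[C]_n.+1 := limn (expsum A).

Definition sum_absmx A : R := \sum_i \sum_j absc (A i j).

Lemma sum_absmx_ge0 A : 0 <= sum_absmx A.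
Proof. by rewrite !sumr_ge0// => i _; rewrite sumr_ge0// => j _; exact: absc_ge0. Qed.

Lemma absc_expr_mx A k i j : absc ((A ^+ k) i j) <= sum_absmx A ^+ k.
Proof.
elim: k i j => [|k IH] i j; first by rewrite !expr0 mxE absc_nat lern1 leq_b1.
rewrite !exprS mxE (le_trans (absc_sum _ _ _))//.
under eq_bigr do rewrite abscM.
rewrite (@le_trans _ _ (\sum_l absc (A i l) * sum_absmx A ^+ k))//.
  by rewrite ler_sum// => l _; rewrite ler_wpM2l ?absc_ge0.
rewrite -mulr_suml ler_wpM2r ?exprn_ge0 ?sum_absmx_ge0//.
rewrite /sum_absmx [leRHS](bigD1 i)//= lerDl sumr_ge0// => l _.
by rewrite sumr_ge0// => j' _; exact: absc_ge0.
Qed.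

Lemma expsum_mxE A k i j :
  expsum A k i j = series (fun l => (l`!%:R)^-1 * (A ^+ l) i j) k.
Proof. by rewrite /expsum /series /= summxE; apply: eq_bigr => l _; rewrite mxE. Qed.

(** Each entry of the series is dominated by the real exponential series at [sum_absmx A]. *)
Lemma cvg_expmx A : expsum A @ \oo --> expmx A.
Proof.
suff [L AL] : exists L : 'M[C]_n.+1, expsum A @ \oo --> L.
  by rewrite /expmx (cvg_lim _ AL)//; exact: norm_hausdorff.
have /choice[L AL] : forall ij : 'I_n.+1 * 'I_n.+1, exists l : C,
    series (fun l => (l`!%:R)^-1 * (A ^+ l) ij.1 ij.2) @ \oo --> l.
  move=> [i j]; apply: (is_cvg_series_absc (b := exp_coeff (sum_absmx A))) => [k|].
    rewrite abscM absc_natV /exp_coeff /= mulrC.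
    by rewrite ler_wpM2r ?invr_ge0 ?ler0n// absc_expr_mx.
  exact: is_cvg_series_exp_coeff.
exists (\matrix_(i, j) L (i, j)); apply: cvg_mxP => i j; rewrite mxE.
by under eq_fun do rewrite expsum_mxE; exact: (AL (i, j)).
Qed.

(** Lets [expsumM_subD] be applied to real numbers, regarded as an algebra over themselves. *)
Lemma expsumR (x : R) : expsum (x : R^o) = series (exp_coeff x).
Proof.
by apply/funext => k; apply: eq_bigr => i _; rewrite /exp_coeff /= mulrC.
Qed.

(* The entries of e_k(A) e_k(B) - e_k(A + B) are bounded by n + 1 times the same
   expression at the real numbers sum_absmx A and sum_absmx B, which tends to 0
   by the addition formula for expR. *)
Lemma expmxD A B : GRing.comm A B -> expmx (A + B) = expmx A * expmx B.
Proof.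
move=> AB; pose x := sum_absmx A; pose y := sum_absmx B.
pose d k := n.+1%:R * (series (exp_coeff x) k * series (exp_coeff y) k
                        - series (exp_coeff (x + y)) k).
have d0 : d @ \oo --> (0 : R).
  have cvgE (t : R) : series (exp_coeff t) @ \oo --> expR t.
    exact: is_cvg_series_exp_coeff.
  rewrite -(mulr0 n.+1%:R) -(subrr (expR (x + y))) {1}expRD.
  by apply: cvgM; [exact: cvg_cst|apply: cvgB; [apply: cvgM|]]; exact: cvgE.
pose D k : 'M[C]_n.+1 := expsum A k * expsum B k - expsum (A + B) k.
have D0 : D @ \oo --> (0 : 'M[C]_n.+1).
  apply: cvg_mxP => i j; rewrite mxE; apply: cvg_absc_le d0; apply: nearW => k.
  rewrite subr0 /D expsumM_subD// summxE (le_trans (absc_sum _ _ _))//.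
  rewrite /d -!expsumR expsumM_subD; last exact: mulrC.
  rewrite mulr_sumr ler_sum// => p _; rewrite summxE (le_trans (absc_sum _ _ _))//.
  rewrite mulr_sumr ler_sum// => q _; rewrite mxE !abscM !absc_natV.
  rewrite mulrCA ler_wpM2l ?mulr_ge0 ?invr_ge0 ?ler0n//.
  rewrite mxE (le_trans (absc_sum _ _ _))//.
  rewrite -[n.+1 in leRHS]card_ord mulr_natl -sumr_const ler_sum// => l _.
  by rewrite abscM ler_pM ?absc_ge0 ?absc_expr_mx.
have D1 : D @ \oo --> (expmx A * expmx B - expmx (A + B) : 'M[C]_n.+1).
  by apply: cvgB; [apply: cvg_mulmx|]; exact: cvg_expmx.
apply/esym/eqP; rewrite -subr_eq0; apply/eqP.
rewrite -(cvg_lim (@norm_hausdorff _ _) D1).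
by apply: cvg_lim D0; exact: norm_hausdorff.
Qed.

End ExpMx.

Section ExpMxTheory.
Variables (R : realType) (n : nat).
Local Notation C := (R[i] : numClosedFieldType).
Implicit Types (A B P : 'M[C]_n.+1).

Lemma expmx_scalar (a l : C) :
  series (fun i => (i`!%:R)^-1 * a ^+ i) @ \oo --> l ->
  expmx (a%:M : 'M[C]_n.+1) = l%:M.
Proof.
move=> al; apply: cvg_lim; first exact: norm_hausdorff.
apply: cvg_mxP => i j; rewrite mxE.
under eq_fun => k do rewrite expsum_mxE.
rewrite [X in X @ _](_ : _ =
  (fun k => series (fun i => (i`!%:R)^-1 * a ^+ i) k *+ (i == j))).
  by case: (i == j); [exact: al|exact: cvg_cst].
apply/funext => k; rewrite /series /= -sumrMnl; apply: eq_bigr => l' _.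
by rewrite -[a%:M]/(scalar_mx a) -rmorphXn mxE mulrnAr.
Qed.

Lemma expmx0 : expmx (0 : 'M[C]_n.+1) = 1.
Proof.
have -> : (0 : 'M[C]_n.+1) = 0%:M by rewrite raddf0.
rewrite (@expmx_scalar 0 1)//.
apply: cvg_near_cst; near=> k.
have k0 : (0 < k)%N by near: k; exact: nbhs_infty_gt.
rewrite /series /= -(prednK k0) big_nat_recl// expr0 mulr1 fact0 invr1.
by rewrite big1 ?addr0// => i _; rewrite expr0n mulr0.
Unshelve. all: by end_near. Qed.

Lemma expmxN A : expmx A * expmx (- A) = 1.
Proof. by rewrite -expmxD ?subrr ?expmx0//; apply: commrN; exact: commr_refl. Qed.

(** Two consecutive terms of the exponential series yield one term of cosh and one of sinh, so
    truncations of even length are the ones to compare. *)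
Lemma cvg_expsum_double A : (fun k => expsum A (2 * k)) @ \oo --> expmx A.
Proof.
apply: (@cvg_comp _ _ _ (muln 2) (expsum A) \oo \oo); first exact: cvg_mulnl.
exact: cvg_expmx.
Qed.

Lemma expsum_double A k : expsum A (2 * k.+1) = expsum A (2 * k)
  + (((2 * k)`!%:R : C)^-1 *: A ^+ (2 * k)
     + ((2 * k).+1`!%:R : C)^-1 *: A ^+ (2 * k).+1).
Proof. by rewrite mulnS !expsumS addrA. Qed.

Lemma expsum_even A k : 2^-1 *: (expsum A (2 * k) + expsum (- A) (2 * k)) =
  series (fun k : nat => ((2 * k)`!%:R : C)^-1 *: A ^+ (2 * k)) k.
Proof.
rewrite /series /= big_mkord; elim: k => [|k IH].
  by rewrite muln0 !expsum0 addr0 scaler0 big_ord0.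
rewrite big_ord_recr -IH !expsum_double addrACA scalerDr; congr (_ + _).
have -> : (- A) ^+ (2 * k) = A ^+ (2 * k) by rewrite !exprM sqrrN.
have -> : (- A) ^+ (2 * k).+1 = - A ^+ (2 * k).+1 by rewrite !exprS !exprM sqrrN mulNr.
rewrite addrACA scalerN subrr addr0.
by rewrite -mulr2n -scalerMnr scalerMnl -mulr_natr mulVf ?scale1r ?pnatr_eq0.
Qed.

Lemma expsum_odd A k : 2^-1 *: (expsum A (2 * k) - expsum (- A) (2 * k)) =
  series (fun k : nat => ((2 * k).+1`!%:R : C)^-1 *: A ^+ (2 * k).+1) k.
Proof.
rewrite /series /= big_mkord; elim: k => [|k IH].
  by rewrite muln0 !expsum0 subr0 scaler0 big_ord0.
rewrite big_ord_recr -IH !expsum_double opprD addrACA scalerDr; congr (_ + _).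
have -> : (- A) ^+ (2 * k) = A ^+ (2 * k) by rewrite !exprM sqrrN.
have -> : (- A) ^+ (2 * k).+1 = - A ^+ (2 * k).+1 by rewrite !exprS !exprM sqrrN mulNr.
rewrite opprD addrACA scalerN opprK subrr add0r.
by rewrite -mulr2n -scalerMnr scalerMnl -mulr_natr mulVf ?scale1r ?pnatr_eq0.
Qed.

Lemma coshmxE A : coshmx A = 2^-1 *: (expmx A + expmx (- A)).
Proof.
have : (fun k => 2^-1 *: (expsum A (2 * k) + expsum (- A) (2 * k)) : 'M[C]_n.+1)
    @ \oo --> (2^-1 *: (expmx A + expmx (- A)) : 'M[C]_n.+1).
  by apply: cvgZr; apply: cvgD; exact: cvg_expsum_double.
by rewrite (funext (expsum_even A)); apply: cvg_lim; exact: norm_hausdorff.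
Qed.

Lemma sinhmxE A : sinhmx A = 2^-1 *: (expmx A - expmx (- A)).
Proof.
have : (fun k => 2^-1 *: (expsum A (2 * k) - expsum (- A) (2 * k)) : 'M[C]_n.+1)
    @ \oo --> (2^-1 *: (expmx A - expmx (- A)) : 'M[C]_n.+1).
  by apply: cvgZr; apply: cvgB; exact: cvg_expsum_double.
by rewrite (funext (expsum_odd A)); apply: cvg_lim; exact: norm_hausdorff.
Qed.

(** The partial sums times [P] are constant from the [m]-th on; this makes the exponential
    polynomial on one generalized eigenspace. *)
Lemma expmx_mul_nilpotent A P m : (forall k, (m <= k)%N -> A ^+ k * P = 0) ->
  expmx A * P = expsum A m * P.
Proof.
move=> AP.
have H : (fun k => expsum A k *m P) @ \oo --> expmx A *m P.
  by apply: cvg_mulmx; [exact: cvg_expmx|exact: cvg_cst].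
rewrite -[LHS](cvg_lim (@norm_hausdorff _ _) H).
apply: cvg_lim; first exact: norm_hausdorff.
apply: cvg_near_cst; near=> k.
have mk : (m <= k)%N by near: k; exact: nbhs_infty_ge.
rewrite !expsumE -!(big_mkord xpredT (fun i => (i`!%:R)^-1 *: A ^+ i)).
rewrite (@big_cat_nat _ _ _ m)//= mulmxDl [X in _ + X]mulmx_suml [X in _ + X]big_nat.
rewrite [X in _ + X]big1 ?addr0// => i /andP[mi _].
by rewrite -scalemxAl [_ *m _]AP ?scaler0.
Unshelve. all: by end_near. Qed.

End ExpMxTheory.

(** * The complex exponential *)

Section ComplexExp.
Variable R : realType.
Local Notation C := (R[i] : numClosedFieldType).
Implicit Types (z w : C) (x y : R).

(** The explicit form gives the addition formula directly; [cvg_cexp] identifies it with the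
    exponential series. *)
Definition cexp z : C :=
  Complex (expR (complex.Re z) * cos (complex.Im z))
          (expR (complex.Re z) * sin (complex.Im z)).

Lemma cexpD z w : cexp (z + w) = cexp z * cexp w.
Proof.
case: z w => [a b] [c d]; rewrite /cexp /= expRD cosD sinD.
by apply/eqP; rewrite eq_complex /=; apply/andP; split; apply/eqP; ring.
Qed.

Lemma cexp0 : cexp 0 = 1.
Proof. by rewrite /cexp /= expR0 cos0 sin0 mulr0 mulr1. Qed.

Lemma cvg_expsum_real x :
  series (fun i => (i`!%:R)^-1 * (x%:C%C : C) ^+ i) @ \oo --> ((expR x)%:C%C : C).
Proof.
have H k : series (fun i => (i`!%:R)^-1 * (x%:C%C : C) ^+ i) k =
    (series (exp_coeff x) k)%:C%C.
  rewrite /series /= rmorph_sum; apply: eq_bigr => i _.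
  by rewrite /exp_coeff /= mulrC rmorphM fmorphV rmorphXn rmorph_nat.
apply: cvgC => /=; first by under eq_fun do rewrite H; exact: is_cvg_series_exp_coeff.
by under eq_fun do rewrite H; exact: cvg_cst.
Qed.

Lemma cvg_expsum_imag y :
  series (fun i => (i`!%:R)^-1 * (Complex 0 y : C) ^+ i) @ \oo -->
  (Complex (cos y) (sin y) : C).
Proof.
have H i : (i`!%:R)^-1 * (Complex 0 y : C) ^+ i =
    Complex (cos_coeff y i) (sin_coeff y i).
  have iy : Complex 0 y = 'i%C * y%:C%C :> C.
    by apply/eqP; rewrite eq_complex /=; apply/andP; split; apply/eqP; ring.
  rewrite iy exprMn /cos_coeff /sin_coeff /=.
  have -> : (i`!%:R : C)^-1 = ((i`!%:R : R)^-1)%:C%C by rewrite fmorphV rmorph_nat.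
  have -> : (y%:C%C : C) ^+ i = (y ^+ i)%:C%C by rewrite rmorphXn.
  (* Even powers of the imaginary unit are real and odd ones imaginary; [i./2] and [i.-1./2] match
     the exponents in [cos_coeff] and [sin_coeff]. *)
  have -> : ('i%C : C) ^+ i =
      Complex ((~~ odd i)%:R * (-1) ^+ i./2) ((odd i)%:R * (-1) ^+ i.-1./2).
    rewrite -{1}(odd_double_half i) exprD -mul2n exprM sqr_i.
    rewrite -(rmorphN1 (real_complex R)) -rmorphXn /=.
    case: i => [|i] /=; first by rewrite !mul1r mul0r.
    have [oi|oi] := boolP (odd i); rewrite /= ?uphalf_half ?oi.
      by rewrite expr0 mul1r mul1r mul0r.
    rewrite (negPf oi) add0n expr1.
    by apply/eqP; rewrite eq_complex /=; apply/andP; split; apply/eqP; ring.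
  rewrite -exprnP.
  by apply/eqP; rewrite eq_complex /=; apply/andP; split; apply/eqP; ring.
apply: cvgC => /=.
  under eq_fun do rewrite Re_sum; under eq_fun do under eq_bigr do rewrite H /=.
  by rewrite unlock; exact: is_cvg_series_cos_coeff.
under eq_fun do rewrite Im_sum; under eq_fun do under eq_bigr do rewrite H /=.
by rewrite unlock; exact: is_cvg_series_sin_coeff.
Qed.

Lemma expmx_cexp n z : expmx (z%:M : 'M[C]_n.+1) = (cexp z)%:M.
Proof.
have -> : (z%:M : 'M[C]_n.+1) = (complex.Re z)%:C%C%:M + (Complex 0 (complex.Im z))%:M.
  rewrite -raddfD; congr (_%:M); case: z => a b.
  by apply/eqP; rewrite eq_complex /= addr0 add0r !eqxx.
rewrite expmxD; last exact: comm_mx_scalar.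
rewrite (expmx_scalar _ (@cvg_expsum_real _)) (expmx_scalar _ (@cvg_expsum_imag _)).
rewrite -[LHS]scalar_mxM; congr (_%:M).
by apply/eqP; rewrite eq_complex /=; apply/andP; split; apply/eqP;
  rewrite mul0r ?subr0 ?addr0.
Qed.

(* The case of 1 x 1 matrices transfers the series of cexp to scalars. *)
Lemma cvg_cexp z : series (fun i => (i`!%:R)^-1 * z ^+ i) @ \oo --> cexp z.
Proof.
have -> : cexp z = expmx (z%:M : 'M[C]_1) 0 0 by rewrite expmx_cexp mxE mulr1n.
rewrite (_ : series _ = fun k => expsum (z%:M : 'M[C]_1) k 0 0).
  by apply: cvg_mx_coord; exact: cvg_expmx.
apply/funext => k; rewrite expsum_mxE; apply: eq_bigr => l _.
by rewrite -[z%:M]/(scalar_mx z) -rmorphXn mxE mulr1n.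
Qed.


End ComplexExp.

(** * Principal branches of the square root and the logarithm *)

Section Caratheodory.
Variable K : numFieldType.

(** Caratheodory's form of the derivative: off [z] the difference quotient is [g], whose limit is
    [g z]. It suits inverse functions, whose slope is the reciprocal of an explicit one. *)
Lemma caratheodory_is_derive (f g : K -> K) (z : K) :
  (\forall w \near z, f w - f z = g w * ((w : K) - z)) ->
  {for z, continuous g} -> is_derive z 1 f (g z).
Proof.
move=> fg cg.
suff H : h^-1 *: ((f \o shift z) h%:A - f z) @[h --> 0^'] --> g z.
  by apply: DeriveDef; [apply/cvg_ex; exists (g z)|exact: cvg_lim H].
have gz : (g \o shift z) y @[y --> 0^'] --> g z by exact/continuous_withinNshiftx.
have fg0 : \forall h \near 0^', f (h + z) - f z = g (h + z) * (h : K).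
  apply: cvg_within; move: fg; rewrite (near_shift 0) subr0.
  by apply: filterS => h /=; rewrite addrK.
apply: cvg_trans gz; apply: near_eq_cvg; near=> h.
have h0 : h != 0 by near: h; exact: nbhs_dnbhs_neq.
rewrite /= [_%:A]mulr1; have -> : f (h + z) - f z = g (h + z) * h by near: h.
by rewrite [RHS]mulrC mulfK.
Unshelve. all: by end_near. Qed.

Lemma is_derive_compN (f : K -> K) (z l : K) :
  is_derive (- z) 1 f l -> is_derive z 1 (fun w : K => f (- w)) (- l).
Proof.
move=> [df fl].
have H : h^-1 *: ((f \o shift (- z)) h%:A - f (- z)) @[h --> 0^'] --> l.
  by rewrite -fl; exact: df.
have N0 : -%R @ (0 : K)^' --> (0 : K)^'.
  move=> A; rewrite -{1}oppr0 dnbhsN => -[B B0 <-].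
  by apply: filterS B0 => x Bx; exists x.
suff fN : h^-1 *: (((fun w : K => f (- w)) \o shift z) h%:A - f (- z))
    @[h --> 0^'] --> - l.
  by apply: DeriveDef; [apply/cvg_ex; exists (- l)|exact: cvg_lim fN].
have NH : - ((- h)^-1 *: ((f \o shift (- z)) (- h)%:A - f (- z))) @[h --> 0^'] --> - l.
  exact: (cvgN (cvg_comp _ _ N0 H)).
apply: cvg_trans NH; apply: near_eq_cvg; apply: nearW => h /=.
by rewrite invrN scaleNr opprK scaleNr opprD.
Qed.

End Caratheodory.

(** * Limits through the real-valued modulus *)

Section AbscLimits.
Variable R : realType.
Local Notation C := (R[i] : numClosedFieldType).

Lemma absc_triangle (z w : C) : absc (z + w) <= absc z + absc w.
Proof. by rewrite -lecR rmorphD !absc_normE ler_normD. Qed.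

Lemma absc_gt0 (z : C) : (0 < absc z) = (z != 0).
Proof. by rewrite -ltcR absc_normE normr_gt0. Qed.

Lemma abscN (z : C) : absc (- z) = absc z.
Proof. by apply: complexI; rewrite !absc_normE normrN. Qed.

Lemma abscV (z : C) : absc z^-1 = (absc z)^-1.
Proof. by apply: complexI; rewrite fmorphV !absc_normE normfV. Qed.

Lemma cvg_absc_sub (T : Type) (F : set_system T) {FF : Filter F} (u : T -> C) (l : C) :
  u @ F --> l -> (fun t => absc (u t - l)) @ F --> 0.
Proof.
move=> /cvgrPdist_lt ul; apply/cvgrPdist_lt => e e0.
have eC : (0 : C) < e%:C%C by rewrite ltcR.
apply: filterS (ul _ eC) => t.
by rewrite distrC -absc_normE ltcR sub0r normrN ger0_norm ?absc_ge0.
Qed.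

Lemma cvg_absc (T : Type) (F : set_system T) {FF : Filter F} (u : T -> C) (l : C) :
  u @ F --> l -> (fun t => absc (u t)) @ F --> absc l.
Proof.
move=> /cvg_absc_sub ul; apply/cvgrPdist_lt => e e0.
move/cvgrPdist_lt : ul => /(_ e e0); apply: filterS => t; rewrite sub0r normrN.
apply: le_lt_trans; rewrite (ger0_norm (absc_ge0 _)).
have h1 := absc_triangle (u t - l) l; have h2 := absc_triangle (- (u t - l)) (u t).
rewrite subrK in h1; rewrite abscN opprB subrK in h2.
by rewrite ler_norml; apply/andP; split; lra.
Qed.

Lemma cvg_Re (T : Type) (F : set_system T) {FF : Filter F} (u : T -> C) (l : C) :
  u @ F --> l -> (fun t => complex.Re (u t)) @ F --> complex.Re l.
Proof.
move=> /cvg_absc_sub ul; apply/cvgrPdist_lt => e e0.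
move/cvgrPdist_lt : ul => /(_ e e0); apply: filterS => t; rewrite sub0r normrN.
apply: le_lt_trans; rewrite (ger0_norm (absc_ge0 _)) distrC.
by rewrite (le_trans _ (absc_Re _))//; case: (u t) l => [a b] [c d].
Qed.

Lemma cvg_Im (T : Type) (F : set_system T) {FF : Filter F} (u : T -> C) (l : C) :
  u @ F --> l -> (fun t => complex.Im (u t)) @ F --> complex.Im l.
Proof.
move=> /cvg_absc_sub ul; apply/cvgrPdist_lt => e e0.
move/cvgrPdist_lt : ul => /(_ e e0); apply: filterS => t; rewrite sub0r normrN.
apply: le_lt_trans; rewrite (ger0_norm (absc_ge0 _)) distrC.
by rewrite (le_trans _ (absc_Im _))//; case: (u t) l => [a b] [c d].
Qed.

(** The terms of degree 0 and 1 cancel, and the rest of the series is bounded termwise by that of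
    the real exponential. *)
Lemma absc_cexp_sub (z : C) : absc (cexp z - 1 - z) <= expR (absc z) - 1 - absc z.
Proof.
have uz := @cvg_cexp _ z.
have uz1 : (fun k => series (fun i => (i`!%:R)^-1 * z ^+ i) k - 1 - z) @ \oo -->
    (cexp z - 1 - z : C).
  exact: (cvgB (cvgB uz (cvg_cst _)) (cvg_cst _)).
have vz : series (exp_coeff (absc z)) @ \oo --> expR (absc z).
  exact: is_cvg_series_exp_coeff.
apply: (ler_cvg_to
  (f := fun k => absc (series (fun i => (i`!%:R)^-1 * z ^+ i) k - 1 - z))
  (g := fun k => series (exp_coeff (absc z)) k - 1 - absc z) (a := \oo)).
- exact: (@cvg_absc _ _ _ _ _ uz1).
- apply: cvgB; last exact: cvg_cst.
  by apply: cvgB; last exact: cvg_cst.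
have tail (V : zmodType) (f : nat -> V) k :
    series f k.+2 - f 0 - f 1 = \sum_(i < k) f i.+2.
  rewrite /series /= !big_nat_recl// big_mkord.
  by rewrite [f 0 + _]addrC addrK [f 1 + _]addrC addrK.
near=> k; have k2 : (1 < k)%N by near: k; exact: nbhs_infty_gt.
have -> : k = k.-2.+2 by case: (k) k2 => [|[]].
have -> : series (fun i => (i`!%:R)^-1 * z ^+ i) k.-2.+2 - 1 - z =
    \sum_(i < k.-2) (i.+2`!%:R)^-1 * z ^+ i.+2.
  by rewrite -(tail _ (fun i => (i`!%:R)^-1 * z ^+ i)) /= fact0 invr1 !mul1r.
have -> : series (exp_coeff (absc z)) k.-2.+2 - 1 - absc z =
    \sum_(i < k.-2) exp_coeff (absc z) i.+2.
  by rewrite -(tail _ (exp_coeff (absc z))) /exp_coeff /= expr0 fact0 !divr1.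
rewrite (le_trans (absc_sum _ _ _))// ler_sum// => i _.
rewrite abscM absc_natV /exp_coeff /= mulrC ler_wpM2r ?invr_ge0 ?ler0n//.
have absX m : absc (z ^+ m) = absc z ^+ m.
  by apply: complexI; rewrite rmorphXn !absc_normE normrX.
by rewrite absX.
Unshelve. all: by end_near. Qed.

End AbscLimits.

(** * Square root and logarithm on the slit plane *)

Section SlitPlane.
Variable R : realType.
Local Notation C := (R[i] : numClosedFieldType).
Implicit Types (z w : C) (p q : R).

(* The plane cut along the closed negative half-line. *)
Definition slit z := 0 < complex.Re (sqrtc z).

Lemma Re_sqrtc_ge0 z : 0 <= complex.Re (sqrtc z).
Proof. by case: z => a b; rewrite /sqrtc /= sqrtr_ge0. Qed.

(** If the root has real part 0, its square [z] is a nonpositive real. *)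
Lemma slitP z : z != 0 -> ~~ (z < 0) -> slit z.
Proof.
move=> z0; apply: contraR; rewrite /slit -leNgt => p_le0.
have /eqP : complex.Re (sqrtc z) == 0 by rewrite eq_le p_le0 Re_sqrtc_ge0.
move: z0 {p_le0}; have := sqr_sqrtc z; case: (sqrtc z) => p q <- /= z0 p0.
rewrite p0 in z0 *; rewrite lt_neqAle z0 /=.
by rewrite expr2 lecE /= !(mul0r, mulr0, add0r, sub0r) eqxx oppr_le0 -expr2 sqr_ge0.
Qed.

Lemma slit_neq0 z : slit z -> z != 0.
Proof. by apply: contraTneq => ->; rewrite /slit sqrtc0 ltxx. Qed.

(** Factor w - z as a difference of squares of roots; the sum of the roots has real part at least
    that of [sqrtc z], because [sqrtc w] has nonnegative real part. *)
Lemma absc_sqrtc_sub z w : slit z ->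
  absc (sqrtc w - sqrtc z) <= absc (w - z) / complex.Re (sqrtc z).
Proof.
move=> sz; rewrite ler_pdivlMr//.
rewrite -[w in leRHS]sqr_sqrtc -[z in leRHS]sqr_sqrtc subr_sqr abscM.
rewrite ler_wpM2l ?absc_ge0// (le_trans _ (absc_Re _))//.
have -> : complex.Re (sqrtc w + sqrtc z) = complex.Re (sqrtc w) + complex.Re (sqrtc z).
  by case: (sqrtc w) (sqrtc z) => [a b] [c d].
by rewrite ger0_norm ?addr_ge0 ?Re_sqrtc_ge0// lerDr Re_sqrtc_ge0.
Qed.

Lemma continuous_sqrtc z : slit z -> {for z, continuous (@sqrtc R : C -> C)}.
Proof.
move=> sz; apply: (@cvg_absc_le _ _ (nbhs z) _ _ _
  (fun w : C => absc (w - z) / complex.Re (sqrtc z))).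
  by apply: nearW => w; exact: absc_sqrtc_sub.
rewrite -(mul0r (complex.Re (sqrtc z))^-1); apply: cvgM; last exact: cvg_cst.
by apply: (@cvg_absc_sub _ _ (nbhs z) _ id); exact: cvg_id.
Qed.

Lemma near_slit z : slit z -> \forall w \near z, slit w.
Proof.
move=> sz; have sw : (fun w : C => complex.Re (sqrtc w)) @ z --> complex.Re (sqrtc z).
  exact: cvg_Re (continuous_sqrtc sz).
exact: (cvgr_gt _ sw _ sz).
Qed.

(** The slope of the root between [w] and [z] is the reciprocal of the sum of the two roots, a sum
    that tends to twice [sqrtc z]. *)
Lemma is_derive_sqrtc z : slit z ->
  is_derive z 1 (@sqrtc R : C -> C) (2^-1 * sqrtc z / z).
Proof.
move=> sz; have s0 : sqrtc z != 0 by rewrite sqrtc_eq0 slit_neq0.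
have sum0 w : slit w -> sqrtc w + sqrtc z != 0.
  move=> sw; apply/eqP => /(congr1 (@complex.Re R)).
  move: sw sz; rewrite /slit; case: (sqrtc w) (sqrtc z) => [a b] [c d] /= a0 c0 /eqP.
  by rewrite gt_eqF// addr_gt0.
have -> : 2^-1 * sqrtc z / z = (sqrtc z + sqrtc z)^-1.
  rewrite -[z in _ / z]sqr_sqrtc; field.
  by rewrite s0 sum0.
apply: (@caratheodory_is_derive _ _ (fun w => (sqrtc w + sqrtc z)^-1)).
  apply: filterS (near_slit sz) => w sw.
  have -> : w - z = (sqrtc w - sqrtc z) * (sqrtc w + sqrtc z).
    by rewrite -subr_sqr !sqr_sqrtc.
  by rewrite mulrCA mulVf ?mulr1 ?sum0.
have cs : (fun w : C => sqrtc w + sqrtc z) @ z --> (sqrtc z + sqrtc z : C).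
  exact: cvgD (continuous_sqrtc sz) (cvg_cst _).
exact: (cvgV (sum0 z sz) cs).
Qed.

(** For p > 0 the number p + iq has argument atan (q / p), so this is the cosine of the argument of
    its square. *)
Lemma cos_atan_double p q : 0 < p ->
  cos (atan (q / p) *+ 2) = (p ^+ 2 - q ^+ 2) / (p ^+ 2 + q ^+ 2).
Proof.
move=> p0; rewrite cos_mulr2n cos_atan exprVn sqr_sqrtr; last first.
  by rewrite addr_ge0// sqr_ge0.
have pq : p ^+ 2 + q ^+ 2 != 0 by rewrite gt_eqF// ltr_wpDr ?sqr_ge0 ?exprn_gt0.
by field; rewrite pq gt_eqF.
Qed.

Lemma sin_atan_double p q : 0 < p ->
  sin (atan (q / p) *+ 2) = (p * q *+ 2) / (p ^+ 2 + q ^+ 2).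
Proof.
move=> p0; rewrite sin_mulr2n.
have c0 : cos (atan (q / p)) != 0.
  by rewrite gt_eqF// cos_gt0_pihalf// atan_gtNpi2 atan_ltpi2.
have -> : sin (atan (q / p)) = q / p * cos (atan (q / p)).
  by rewrite -{2}[q / p]atanK /tan divfK.
rewrite mulrCA -expr2 cos_atan exprVn sqr_sqrtr; last first.
  by rewrite addr_ge0// sqr_ge0.
have pq : p ^+ 2 + q ^+ 2 != 0 by rewrite gt_eqF// ltr_wpDr ?sqr_ge0 ?exprn_gt0.
by field; rewrite pq gt_eqF.
Qed.

Lemma ReIm_sqr z :
  [/\ complex.Re z = complex.Re (sqrtc z) ^+ 2 - complex.Im (sqrtc z) ^+ 2,
  complex.Im z = complex.Re (sqrtc z) * complex.Im (sqrtc z) *+ 2 &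
  absc z = complex.Re (sqrtc z) ^+ 2 + complex.Im (sqrtc z) ^+ 2].
Proof.
case E: (sqrtc z) => [p q] /=.
have -> : z = Complex (p ^+ 2 - q ^+ 2) (p * q *+ 2).
  by apply/eqP; rewrite -[z]sqr_sqrtc E expr2 eq_complex /=;
    apply/andP; split; apply/eqP; ring.
split=> //; rewrite /absc normc_def /=.
have -> : (p ^+ 2 - q ^+ 2) ^+ 2 + (p * q *+ 2) ^+ 2 = (p ^+ 2 + q ^+ 2) ^+ 2 by ring.
by rewrite sqrtr_sqr ger0_norm// addr_ge0 ?sqr_ge0.
Qed.

(** The root lies in the open right half-plane, where atan gives its argument, and squaring doubles
    the argument. This form has no case split, which makes continuity visible. *)
Lemma carg_slit z : slit z ->
  carg z = atan (complex.Im (sqrtc z) / complex.Re (sqrtc z)) *+ 2.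
Proof.
move=> sz; rewrite /carg -/(absc z); have [-> -> ->] := ReIm_sqr z.
move: sz; rewrite /slit; move: (complex.Re _) (complex.Im _) => p q p0.
rewrite -cos_atan_double// pmulrn_lge0// pmulr_rge0//.
have atan_lt := atan_ltpi2 (q / p); have atan_gt := atan_gtNpi2 (q / p).
(* Im z has the sign of q, and [acos] inverts [cos] only on [0, pi]: for q < 0 the opposite angle is
   used. *)
case: leP => q0.
  have a0 : 0 <= atan (q / p) by rewrite -(@atan0 R) le_atan// divr_ge0// ltW.
  by rewrite cosK// in_itv /=; apply/andP; split; lra.
have a0 : atan (q / p) <= 0 by rewrite -(@atan0 R) le_atan// ler_pdivrMr// mul0r ltW.
rewrite -cosN cosK ?opprK// in_itv /=; apply/andP; split; lra.
Qed.

Lemma cexp_cln z : slit z -> cexp (cln z) = z.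
Proof.
move=> sz; rewrite /cexp /cln /= -/(absc z) lnK; last first.
  by rewrite posrE absc_gt0 slit_neq0.
rewrite carg_slit// cos_atan_double// sin_atan_double//.
have z0 := slit_neq0 sz; rewrite -absc_gt0 in z0.
have [zr zi za] := ReIm_sqr z; rewrite -zr -zi -za.
by rewrite ![absc z * _]mulrC !divfK ?gt_eqF//; case: (z).
Qed.

Lemma continuous_cln z : slit z -> {for z, continuous (@cln R : C -> C)}.
Proof.
move=> sz; have sw := continuous_sqrtc sz.
have absz0 : 0 < absc z by rewrite absc_gt0 slit_neq0.
have absz : (fun w : C => absc w) @ z --> absc z.
  by apply: (@cvg_absc _ _ (nbhs z) _ id); exact: cvg_id.
have lnz : (fun w : C => ln (absc w)) @ z --> ln (absc z).
  exact: (continuous_cvg (nbhs_filter z) (continuous_ln absz0) absz).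
apply: (@cvgC _ _ (nbhs z)); first exact: lnz.
rewrite [complex.Im (cln z)]carg_slit//.
have Re_s : (fun w : C => complex.Re (sqrtc w)) @ z --> complex.Re (sqrtc z).
  exact: cvg_Re sw.
have Im_s : (fun w : C => complex.Im (sqrtc w)) @ z --> complex.Im (sqrtc z).
  exact: cvg_Im sw.
have Re0 : complex.Re (sqrtc z) != 0 by rewrite gt_eqF.
have at2 :
    (fun w : C => atan (complex.Im (sqrtc w) / complex.Re (sqrtc w)) *+ 2) @ z -->
    atan (complex.Im (sqrtc z) / complex.Re (sqrtc z)) *+ 2.
  exact: (cvgMn (continuous_cvg (nbhs_filter z) (@continuous_atan _ _)
    (cvgM Im_s (cvgV Re0 Re_s)))).
apply: cvg_trans at2; apply: near_eq_cvg.
by apply: filterS (near_slit sz) => w wz; rewrite /= -carg_slit.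
Qed.

End SlitPlane.

(** * Differential equations of the germs *)

Section Germs.
Variable R : realType.
Local Notation C := (R[i] : numClosedFieldType).
Implicit Types (z w h : C).

Definition cexp_slope h : C := if h == 0 then 1 else (cexp h - 1) / h.

Lemma cexp_slope0 : cexp_slope 0 = 1.
Proof. by rewrite /cexp_slope eqxx. Qed.

Lemma cexp_slopeE h : cexp h - 1 = cexp_slope h * h.
Proof.
by rewrite /cexp_slope; case: eqVneq => [->|h0]; rewrite ?divfK// cexp0 subrr mulr0.
Qed.

(* exp r - 1 - r <= 1 / (1 - r) - 1 - r = r ^ 2 / (1 - r). *)
Lemma expR_sub_le (r : R) : 0 <= r <= 2^-1 -> expR r - 1 - r <= 2 * r ^+ 2.
Proof.
move=> /andP[r0 r2].
have e0 := expR_gt0 r; have eN := expR_ge1Dx (- r).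
have E : expR r * expR (- r) = 1 by rewrite -expRD subrr expR0.
have : expR r * (1 - r) <= 1 by rewrite -[leRHS]E ler_pM2l.
have e1 := expR_ge1Dx r; nra.
Qed.

(** The distance to 1 is |e^h - 1 - h| / |h|, at most 2 |h| near 0. *)
Lemma cvg_cexp_slope : cexp_slope @ (0 : C) --> (1 : C).
Proof.
have h0 : (fun h : C => absc h) @ (0 : C) --> absc (0 : C).
  by apply: (@cvg_absc R _ (nbhs (0 : C)) _ id); exact: cvg_id.
apply: (@cvg_absc_le _ _ (nbhs (0 : C)) _ _ _ (fun h : C => 2 * absc h)).
  have h2 : \forall h \near (0 : C), absc h < 2^-1.
    by apply: (cvgr_lt _ h0); rewrite absc0 invr_gt0.
  apply: filterS h2 => h h2; have [->|hn0] := eqVneq h 0.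
    by rewrite cexp_slope0 subrr absc0 mulr0.
  have -> : cexp_slope h - 1 = (cexp h - 1 - h) / h.
    by rewrite cexp_slopeE mulrBl divff// mulfK.
  rewrite abscM abscV ler_pdivrMr ?absc_gt0//.
  rewrite (le_trans (absc_cexp_sub _))// -mulrA -expr2 expR_sub_le//.
  by rewrite absc_ge0 ltW.
have h20 : (fun h : C => 2 * absc h) @ (0 : C) --> 2 * absc (0 : C).
  exact: (cvgM (cvg_cst _) h0).
by rewrite absc0 mulr0 in h20.
Qed.

(** With h = ln w - ln z one has w - z = z (e^h - 1), so the slope of the logarithm, the reciprocal
    of z times [cexp_slope h], tends to 1 / z. *)
Lemma is_derive_cln z : slit z -> is_derive z 1 (@cln R : C -> C) z^-1.
Proof.
move=> sz; have z0 := slit_neq0 sz.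
have d0 : (fun w : C => cln w - cln z) @ z --> (0 : C).
  by rewrite -(subrr (cln z)); exact: (cvgB (continuous_cln sz) (cvg_cst _)).
have s1 : (fun w : C => cexp_slope (cln w - cln z)) @ z --> (1 : C).
  exact: (cvg_comp _ _ d0 cvg_cexp_slope).
pose g w : C := (z * cexp_slope (cln w - cln z))^-1.
have gz : g z = z^-1 by rewrite /g subrr cexp_slope0 mulr1.
rewrite -gz; apply: caratheodory_is_derive.
  have sn0 : \forall w \near z, cexp_slope (cln w - cln z) != 0.
    exact: (@cvgr_neq0 _ _ _ (nbhs z) _ _ _ s1 (oner_neq0 _)).
  near=> w; have ws : slit w by near: w; exact: near_slit.
  have snw : cexp_slope (cln w - cln z) != 0 by near: w.
  have -> : w - z = z * (cexp_slope (cln w - cln z) * (cln w - cln z)).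
    rewrite -cexp_slopeE mulrBr mulr1 -{2}(cexp_cln sz) -cexpD.
    by rewrite subrKC cexp_cln.
  by rewrite /g [z * (_ * _)]mulrA mulKf// mulf_neq0.
have s1' : (fun w : C => z * cexp_slope (cln w - cln z)) @ z --> (z * 1 : C).
  exact: (cvgM (cvg_cst _) s1).
rewrite mulr1 in s1'; have cg : g @ z --> g z by rewrite gz; exact: (cvgV z0 s1').
exact: cg.
Unshelve. all: by end_near. Qed.

Lemma sqrt_germ_sqr (a : C) : sqrt_germ a a ^+ 2 = a.
Proof. by rewrite sqrt_germ_val sqr_sqrtc. Qed.

Lemma slitN_lt0 (a : C) : a < 0 -> slit (- a).
Proof.
move=> a0; apply: slitP; first by rewrite oppr_eq0 lt_eqF.
by rewrite lt_gtF// oppr_gt0.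
Qed.

(** The equation z f' = c f + d with c = 1/2, d = 0. If a < 0, then - z stays in the slit plane for
    z near a, and composing with - z preserves the equation. *)
Lemma near_is_derive_sqrt_germ (a : C) : a != 0 ->
  \forall z \near a, is_derive (z : C) 1 (sqrt_germ a : C -> C)
    ((2^-1 * sqrt_germ a z + 0) / z).
Proof.
rewrite /sqrt_germ; case: ifPn => [al0 _|al0 a0]; last first.
  apply: filterS (near_slit (slitP a0 al0)) => z /is_derive_sqrtc.
  by rewrite addr0.
have := near_slit (slitN_lt0 al0) => /nearN; apply: filterS => z sz.
have dN := is_derive_compN (is_derive_sqrtc sz).
have := is_deriveZ 'i%C dN; congr (is_derive _ _ _ _).
rewrite /GRing.scale /= addr0 invrN; ring.
Qed.

(** Here c = 0, d = 1; the constant added for a < 0 disappears on differentiation. *)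
Lemma near_is_derive_ln_germ (a : C) : a != 0 ->
  \forall z \near a, is_derive (z : C) 1 (ln_germ a : C -> C)
    ((0 * ln_germ a z + 1) / z).
Proof.
rewrite /ln_germ; case: ifPn => [al0 _|al0 a0]; last first.
  apply: filterS (near_slit (slitP a0 al0)) => z /is_derive_cln.
  by rewrite mul0r add0r mul1r.
have := near_slit (slitN_lt0 al0) => /nearN; apply: filterS => z sz.
have dN := is_derive_compN (is_derive_cln sz).
have := is_deriveD dN (is_derive_cst (Complex 0 pi : C) z 1); congr (is_derive _ _ _ _).
by rewrite mul0r add0r mul1r addr0 invrN opprK.
Qed.

(** For a < 0 the factor e^(i pi) = -1 undoes the passage to - a. *)
Lemma cexp_ln_germ (a : C) : a != 0 -> cexp (ln_germ a a) = a.
Proof.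
rewrite /ln_germ; case: ifPn => [al0 _|al0 a0]; last first.
  by rewrite cexp_cln//; exact: slitP.
rewrite cexpD cexp_cln; last exact: slitN_lt0.
have -> : cexp (Complex 0 pi) = -1 :> C.
  rewrite /cexp /= expR0 cospi sinpi mulr0 mul1r.
  by apply/eqP; rewrite eq_complex /= oppr0 !eqxx.
by rewrite mulrN1 opprK.
Qed.

End Germs.

(* Only the functional equations of the square root, the logarithm and the
   exponential enter the addition formula. *)
Section PhasorAddition.
Variables (K : numClosedFieldType) (n : nat).
Variables sq lg ex ch sh : 'M[K]_n.+1 -> 'M[K]_n.+1.
Implicit Types (A B M N U W V : 'M[K]_n.+1).
Hypothesis sqK : forall W, W \in unitmx -> sq W *m sq W = W.
Hypothesis comm_sq : forall W V, comm_mx W V -> comm_mx (sq W) V.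
Hypothesis exK : forall W, W \in unitmx -> ex (lg W) = W.
Hypothesis comm_lg : forall W V, comm_mx W V -> comm_mx (lg W) V.
Hypothesis exD : forall A B, comm_mx A B -> ex (A + B) = ex A *m ex B.
Hypothesis exN : forall A, ex A *m ex (- A) = 1%:M.
Hypothesis chE : forall A, ch A = 2^-1 *: (ex A + ex (- A)).
Hypothesis shE : forall A, sh A = 2^-1 *: (ex A - ex (- A)).

Lemma sq_unitmx W : W \in unitmx -> sq W \in unitmx.
Proof. by move=> Wu; have := Wu; rewrite -{1}(sqK Wu) unitmx_mul => /andP[]. Qed.

Lemma phasor_addition M N U : M + N \in unitmx -> M - N \in unitmx ->
  comm_mx M N -> comm_mx M U -> comm_mx N U ->
  M *m ch U + N *m sh U =
    sq (M + N) *m sq (M - N) *m ch (lg (invmx (sq (M - N)) *m sq (M + N)) + U) /\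
  sq (M + N) *m sq (M - N) *m (sq (M + N) *m sq (M - N)) = (M + N) *m (M - N).
Proof.
move=> pu mu cMN cMU cNU.
have cpm : comm_mx (M + N) (M - N).
  by apply: comm_mxB; apply: comm_mx_sym; apply: comm_mxD => //; exact: comm_mx_sym.
have cpU : comm_mx (M + N) U.
  by apply: comm_mx_sym; apply: comm_mxD; exact: comm_mx_sym.
have cmU : comm_mx (M - N) U.
  by apply: comm_mx_sym; apply: comm_mxB; exact: comm_mx_sym.
have cxy : comm_mx (sq (M + N)) (sq (M - N)).
  exact/comm_sq/comm_mx_sym/comm_sq/comm_mx_sym.
move: (comm_sq cpU) (comm_sq cmU) cxy (sqK pu) (sqK mu) (sq_unitmx pu) (sq_unitmx mu).
move: (sq (M + N)) (sq (M - N)) => x y cxU cyU cxy xx yy xu yu.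
have cWU : comm_mx (invmx y *m x) U.
  apply: comm_mx_sym; apply: (@commrM _ U y^-1 x); last exact: comm_mx_sym.
  by apply: commrV; exact: comm_mx_sym.
have eW : ex (lg (invmx y *m x)) = invmx y *m x.
  by apply: exK; rewrite unitmx_mul unitmx_inv yu.
move: (comm_lg cWU) eW (exN (lg (invmx y *m x))); move: (lg _) => u cuU eW eN.
have xy_u : x *m y *m ex u = M + N by rewrite eW -mulmxA mulKVmx.
have xy_Nu : x *m y *m ex (- u) = M - N.
  by rewrite eW -mulmxA in eN; rewrite cxy -mulmxA -[x *m _](mulKVmx yu) eN mulmx1.
split; last by rewrite -xx -yy -!mulmxA [y *m _]mulmxA -cxy !mulmxA.
have cNN : comm_mx (- u) (- U).
  by apply: comm_mxN; apply: comm_mx_sym; apply: comm_mxN; exact: comm_mx_sym.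
rewrite !chE shE opprD (exD cuU) (exD cNN) -!scalemxAr -scalerDr; congr (_ *: _).
rewrite [RHS]mulmxDr 2![in RHS]mulmxA xy_u xy_Nu !mulmxDr !mulmxDl mulmxN mulNmx.
exact: addrACA.
Qed.

End PhasorAddition.

(** * Square root and logarithm of an invertible matrix *)

Section SqrtLog.
Variables (R : realType) (n : nat).
Local Notation C := (R[i] : numClosedFieldType).
Implicit Types (W V : 'M[C]_n.+1) (p t : {poly C}).

Lemma sqrtmx_sqr W : W \in unitmx -> sqrtmx W * sqrtmx W = W.
Proof.
move=> Wu; rewrite /sqrtmx; have [p pW ->] := primary_funP W (@sqrt_germ R).
apply/eqP; rewrite -subr_eq0; apply/eqP; apply: eq0_minpoly_cofactor => a ra.
have a0 := mxminpoly_root_neq0 Wu ra.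
rewrite -rmorphM -{2}(horner_mx_X W) -rmorphB /=; apply: horner_mx_cofactor.
have pa : p.[a] = sqrt_germ a a by rewrite -[p]derivn0 pW// mup_minpoly_gt0.
apply: (@dvdp_XsubC_exp_euler _ a 1) => //.
  by rewrite !hornerE pa -expr2 sqrt_germ_sqr subrr.
have := euler_interpolation a0 (near_is_derive_sqrt_germ a0) (pW a).
rewrite subr0; set e := 'X * _ - _.
(* With g = p^2 - X, the expression X g' - g factors as 2 p (X p' - p / 2). *)
have -> : 'X * (p * p - 'X)^`() - 1 *: (p * p - 'X) = (p *+ 2) * e.
  have pp : (p *+ 2) * (2^-1 *: p) = p * p.
    rewrite -scalerAr mulrnAl -scalerMnr scalerMnl.
    by rewrite -mulr_natr mulVf ?scale1r ?pnatr_eq0.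
  by rewrite /e mulrBr pp derivB derivM derivX scale1r; ring.
exact: dvdp_mull.
Qed.

(** Differentiation drops one term of the truncation, the source of the remainder in
    [expmx_lnmx]. *)
Lemma deriv_expsum t k : (expsum t k.+1)^`() = t^`() * expsum t k.
Proof.
elim: k => [|k IH].
  by rewrite expsumS !expsum0 add0r expr0 derivZ derivC scaler0 mulr0.
rewrite expsumS derivD IH [in RHS]expsumS mulrDr; congr (_ + _).
rewrite derivZ deriv_exp /= -scalerMnr scalerMnl -scalerAr.
rewrite factS natrM invfM -mulrnAl -[_ *+ k.+1]mulr_natr.
by rewrite mulVf ?mul1r ?pnatr_eq0.
Qed.

Lemma horner_mx_expsum W t k : horner_mx W (expsum t k) = expsum (horner_mx W t) k.
Proof.
elim: k => [|k IH]; first by rewrite !expsum0 rmorph0.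
by rewrite !expsumS rmorphD /= IH linearZ /= rmorphXn.
Qed.

Lemma expmx_lnmx W : W \in unitmx -> expmx (lnmx W) = W.
Proof.
move=> Wu; rewrite /lnmx; have [p pW ->] := primary_funP W (@ln_germ R).
apply/eqP; rewrite -subr_eq0; apply/eqP; apply: eq0_minpoly_cofactor => a ra.
have a0 := mxminpoly_root_neq0 Wu ra.
have m0 : (0 < mup a (mxminpoly W))%N by rewrite mup_minpoly_gt0.
(* Removing the value at [a] makes [t] vanish there, so [t(W)] is nilpotent on the range of the
   cofactor; the exponential of the scalar removed is [a]. *)
pose t := p - (ln_germ a a)%:P; set m := mup _ _ in m0.
have ta : t.[a] = 0 by rewrite !hornerE -[p]derivn0 pW// subrr.
have tm k : ('X - a%:P) ^+ k %| t ^+ k.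
  by rewrite dvdp_exp2r// dvdp_XsubCl; apply/rootP.
have -> : expmx (horner_mx W p) = a *: expmx (horner_mx W t).
  have -> : horner_mx W p = (ln_germ a a)%:M + horner_mx W t.
    by rewrite /t rmorphB /= horner_mx_C subrKC.
  rewrite expmxD; last by apply: comm_mx_sym; exact: comm_mx_scalar.
  by rewrite expmx_cexp cexp_ln_germ// [_ * _]mul_scalar_mx.
rewrite mulrBl -scalerAl (@expmx_mul_nilpotent _ _ _ _ m); last first.
  move=> k mk; rewrite -rmorphXn; apply: horner_mx_cofactor.
  by rewrite (dvdp_trans _ (tm k))// dvdp_exp2l.
rewrite -horner_mx_expsum scalerAl -linearZ -mulrBl -{2}(horner_mx_X W) -rmorphB /=.
apply: horner_mx_cofactor; rewrite -/m.
apply: (@dvdp_XsubC_exp_euler _ a 1) => //.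
  have ea k : (expsum t k.+1).[a] = 1.
    elim: k => [|k IH]; rewrite expsumS hornerD hornerZ horner_exp ta.
      by rewrite expsum0 horner0 add0r expr0 mulr1 fact0 invr1.
    by rewrite IH expr0n mulr0 addr0.
  by rewrite !hornerE -(prednK m0) ea mulr1 subrr.
have := euler_interpolation a0 (near_is_derive_ln_germ a0) (pW a).
rewrite -/m; case: m m0 => // m _ /=.
rewrite scale0r subr0 => He.
have dt : t^`() = p^`() by rewrite /t derivB derivC subr0.
rewrite derivB derivZ derivX deriv_expsum dt expsumS scale1r.
set e := expsum t m.
(* [m] is now the multiplicity minus one. The term dropped on differentiation leaves a multiple of
   t^m, itself divisible by (X - a)^m. *)
have -> : 'X * (a *: (p^`() * e) - 1) - (a *: (e + m`!%:R^-1 *: t ^+ m) - 'X) =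
  a%:P * e * ('X * p^`() - 1) - (a * m`!%:R^-1)%:P * t ^+ m.
  by rewrite -!mul_polyC polyCM; ring.
by rewrite dvdp_sub ?dvdp_mull.
Qed.

Lemma comm_sqrtmx W V : comm_mx W V -> comm_mx (sqrtmx W) V.
Proof. exact: comm_horner_mx. Qed.

Lemma comm_lnmx W V : comm_mx W V -> comm_mx (lnmx W) V.
Proof. exact: comm_horner_mx. Qed.

End SqrtLog.

(** The radical of (M + N)(M - N) is read as S = M0 N0, with its square stated separately: the
    principal root of the product can differ from S, as for 1 x 1 matrices with M + N = M - N = -1,
    where S = -1. *)
Theorem theorem4p13 (R : realType) (n : nat) (M N U : 'M[R[i]]_n.+1)
    (hD : M + N \in unitmx) (hB : M - N \in unitmx)
    (cMN : comm_mx M N) (cMU : comm_mx M U) (cNU : comm_mx N U) :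
  let M0 := sqrtmx (M + N) in
  let N0 := sqrtmx (M - N) in
  let U0 := lnmx (invmx N0 *m M0) in
  let S := M0 *m N0 in
  [/\ M *m coshmx U + N *m sinhmx U = M0 *m N0 *m coshmx (U0 + U),
      S *m S = (M + N) *m (M - N)
    & M *m coshmx U + N *m sinhmx U =
      S *m coshmx (lnmx (invmx (sqrtmx (M - N)) *m sqrtmx (M + N)) + U)].
Proof.
move=> M0 N0 U0 S.
have [eq SS] := phasor_addition (@sqrtmx_sqr _ _) (@comm_sqrtmx _ _)
  (@expmx_lnmx _ _) (@comm_lnmx _ _) (@expmxD _ _) (@expmxN _ _) (@coshmxE _ _)
  (@sinhmxE _ _) hD hB cMN cMU cNU.
by split; [exact: eq|exact: SS|exact: eq].
Qed.
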